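(* For each integer $n\ge 1$ there exists a quasi-weight $\mu_n$ on $\mathrm{Cu}_2\setminus\{\lozenge\}$ such that, with $\mathcal A_n=(\ell^1(\mathrm{Cu}_2\setminus\{\lozenge\},\mu_n),\#)$, we have $C'_{\mathrm{PI}}(\mathcal A_n)=1$ and yet $C_{\mathrm{PI}}(\mathcal A_n)\ge n$.
   Context: $\mathrm{Cu}_2$ is the monoid with identity $e$ and zero element $\lozenge$ (so $\lozenge s=\lozenge=s\lozenge$ for all $s$) generated by $a_1,a_2,b_1,b_2$ subject to the relations $a_1b_1=e=a_2b_2$ and $a_1b_2=\lozenge=a_2b_1$. A weight on a monoid $S$ with identity $e$ is a function $\omega:S\to(0,+\infty)$ with $\omega(st)\le\omega(s)\omega(t)$ for all $s,t\in S$ and $\omega(e)=1$. If $S$ has a zero element $\lozenge$, a quasi-weight is the restriction $\mu=\omega|_{S\setminus\{\lozenge\}}$ of a weight $\omega$ on $S$. Then $\ell^1(S\setminus\{\lozenge\},\mu)$ is the Banach space of $f:S\setminus\{\lozenge\}\to\mathbb C$ with $\|f\|_\mu=\sum_s|f(s)|\mu(s)<\infty$. It becomes a unital Banach algebra (unit $\delta_e$, of norm $1$) with the bounded bilinear product $\#$ determined by $\delta_s\#\delta_t=\delta_{st}$ if $st\ne\lozenge$ and $\delta_s\#\delta_t=0$ if $st=\lozenge$. Idempotents $p,q$ in an algebra are equivalent, $p\sim q$, if $p=ab$, $q=ba$ for some elements $a,b$; they are orthogonal, $p\perp q$, if $pq=0=qp$. For a unital Banach algebra $\mathcal A$, $$C_{\mathrm{PI}}(\mathcal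 A)=\inf\{\|a\|\|b\|\|c\|\|d\| : a,b,c,d\in\mathcal A,\ ab=1=cd,\ ad=0=cb\},$$ $$C'_{\mathrm{PI}}(\mathcal A)=\inf\{\|p\|\|q\| : p,q\in\mathcal A,\ p^2=p,\ q^2=q,\ p\sim 1\sim q,\ p\perp q\},$$ with $\inf\emptyset=+\infty$. *)

(* Defs.v *)
From HB Require Import structures.
From mathcomp Require Import all_boot all_order all_algebra generic_quotient.
From mathcomp Require Import monoid.
From mathcomp Require Import boolp classical_sets functions fsbigop cardinality.
From mathcomp Require Import reals constructive_ereal ereal topology normedtype.
From mathcomp Require Import esum numfun sequences.
From mathcomp Require Import complex.
From mathcomp Require Import ring lra.

Set Implicit Arguments.
Unset Strict Implicit.
Unset Printing Implicit Defensive.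

Import Order.TTheory GRing.Theory Num.Theory.

Local Open Scope classical_set_scope.
Local Open Scope ring_scope.
Local Open Scope quotient_scope.

(* The real modulus; in contrast, `|z| : R[i] for z : R[i]. *)
Local Notation normc := Normc.normc.
Local Notation Re := (@complex.Re _).
Local Notation Im := (@complex.Im _).

Section RealSum.
Context (R : realType).
Implicit Types (T : choiceType).

(* The unordered sum over D of an absolutely summable real family (otherwise
   the value is meaningless). *)
Definition rsum T (D : set T) (h : T -> R) : R :=
  fine (\esum_(t in D) (Num.max (h t) 0)%:E) -
  fine (\esum_(t in D) (Num.max (- h t) 0)%:E).

Lemma esumZl T (D : set T) (c : R) (a : T -> R) : 0 <= c ->
  (forall t, D t -> 0 <= a t) ->
  (\esum_(t in D) (c * a t)%:E = c%:E * \esum_(t in D) (a t)%:E)%E.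
Proof.
move=> c0 a0.
have le_c (k : R) (b : T -> R) : 0 <= k -> (forall t, D t -> 0 <= b t) ->
    (\esum_(t in D) (k * b t)%:E <= k%:E * \esum_(t in D) (b t)%:E)%E.
  move=> k0 b0; apply: ge_ereal_sup => _ [F [finF FD] <-].
  rewrite fsbig_finite//=; under eq_bigr do rewrite EFinM.
  rewrite big_seq -ge0_sume_distrr; last first.
    by move=> t; rewrite in_fset_set// inE => /FD; rewrite lee_fin; exact: b0.
  apply: lee_wpmul2l => //; apply: ereal_sup_ubound; exists F => //.
  by rewrite fsbig_finite// -big_seq.
apply/eqP; rewrite eq_le le_c//=.
have [->|c_neq0] := eqVneq c 0.
  by rewrite mul0e; apply: esum_ge0 => t Dt; rewrite mul0r.
have cp : 0 < c by rewrite lt_neqAle eq_sym c_neq0.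
rewrite -(@lee_pmul2l _ c^-1%:E)//; last by rewrite lte_fin invr_gt0.
rewrite muleA -EFinM mulVf// mul1e.
have := @le_c c^-1 (fun t => c * a t).
rewrite invr_ge0 => /(_ c0) /(_ (fun t Dt => mulr_ge0 c0 (a0 t Dt))).
by apply: le_trans; rewrite le_eqVlt; apply/orP; left; apply/eqP;
  apply: eq_esum => t _; rewrite mulrA mulVf// mul1r.
Qed.

Lemma eq_rsum T (D : set T) (f g : T -> R) :
  (forall t, D t -> f t = g t) -> rsum D f = rsum D g.
Proof.
move=> fg; rewrite /rsum; congr (fine _ - fine _);
  by apply: eq_esum => t Dt; rewrite fg.
Qed.

Lemma summableEFin T (D : set T) (f : T -> R) :
  summable D (EFin \o f) = (\esum_(t in D) (`|f t|)%:E < +oo)%E.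
Proof. by []. Qed.

Lemma le_summable T (D : set T) (f g : T -> R) :
  (forall t, D t -> `|f t| <= `|g t|) ->
  summable D (EFin \o g) -> summable D (EFin \o f).
Proof.
move=> fg; apply: le_lt_trans; apply: le_esum => t Dt /=.
by rewrite lee_fin fg.
Qed.

Lemma summable_fin T (D : set T) (f : T -> R) : (forall t, D t -> 0 <= f t) ->
  summable D (EFin \o f) -> \esum_(t in D) (f t)%:E \is a fin_num.
Proof.
move=> f0 sf; rewrite fin_numElt (lt_le_trans (ltNyr 0))/=; last first.
  by apply: esum_ge0 => t Dt; rewrite lee_fin f0.
move: sf; apply: le_lt_trans; apply: le_esum => t Dt /=.
by rewrite lee_fin ler_norm.
Qed.

Lemma rsumB T (D : set T) (f g : T -> R) :
  (forall t, D t -> 0 <= f t) -> (forall t, D t -> 0 <= g t) ->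
  summable D (EFin \o f) -> summable D (EFin \o g) ->
  rsum D (fun t => f t - g t) =
  fine (\esum_(t in D) (f t)%:E) - fine (\esum_(t in D) (g t)%:E).
Proof.
move=> f0 g0 sf sg.
have := esumB sf sg; rewrite (_ : esum D _ = \esum_(t in D) (Num.max (f t - g t) 0)%:E); last first.
  by apply: eq_esum => t _; rewrite funeposE /= EFin_max.
rewrite (_ : esum D _^\- = \esum_(t in D) (Num.max (- (f t - g t)) 0)%:E)%E; last first.
  by apply: eq_esum => t _; rewrite funenegE /= EFin_max.
move=> /(_ f0 g0) H.
have spos (h : T -> R) : summable D (EFin \o h) ->
    \esum_(t in D) (Num.max (h t) 0)%:E \is a fin_num.
  move=> sh; apply: summable_fin; first by move=> t _; rewrite le_max lexx orbT.
  apply: le_summable sh => t _.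
  by case: (leP (h t) 0) => h0; rewrite ?normr0// ltW.
have sfg : summable D (EFin \o (fun t => f t - g t)) by exact: (summableB sf sg).
have sgf : summable D (EFin \o (fun t => - (f t - g t))).
  by apply: le_summable sfg => t _; rewrite normrN.
apply: EFin_inj; rewrite /rsum !EFinB !fineK ?H//; do ?exact: summable_fin; exact: spos.
Qed.

Lemma summable_max T (D : set T) (h : T -> R) : summable D (EFin \o h) ->
    summable D (EFin \o (fun t => Num.max (h t) 0)).
Proof.
move=> sh; apply: le_summable sh => t _.
by case: (leP (h t) 0) => h0; rewrite ?normr0// ltW.
Qed.

Lemma summable_oppr T (D : set T) (h : T -> R) : summable D (EFin \o h) ->
    summable D (EFin \o (fun t => - h t)).
Proof. by move=> sh; apply: le_summable sh => t _; rewrite normrN. Qed.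

Lemma summable_addr T (D : set T) (f g : T -> R) : summable D (EFin \o f) ->
   summable D (EFin \o g) -> summable D (EFin \o (fun t => f t + g t)).
Proof. by move=> sf sg; exact: (summableD sf sg). Qed.

Lemma maxr_posneg (x : R) : x = Num.max x 0 - Num.max (- x) 0.
Proof.
case: (leP x 0) => x0; first by rewrite max_l ?oppr_ge0// sub0r opprK.
by rewrite max_r ?subr0// oppr_le0 ltW.
Qed.

Lemma max0r_ge0 (x : R) : 0 <= Num.max x 0. Proof. by rewrite le_max lexx orbT. Qed.
Hint Resolve max0r_ge0 : core.

Lemma esumDr T (D : set T) (f g : T -> R) :
  (forall t, D t -> 0 <= f t) -> (forall t, D t -> 0 <= g t) ->
  summable D (EFin \o f) -> summable D (EFin \o g) ->
  fine (\esum_(t in D) (f t + g t)%:E) =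
  fine (\esum_(t in D) (f t)%:E) + fine (\esum_(t in D) (g t)%:E).
Proof.
move=> f0 g0 sf sg; rewrite -fineD; do ?exact: summable_fin.
by rewrite -esumD.
Qed.

Lemma rsumD T (D : set T) (f g : T -> R) :
  summable D (EFin \o f) -> summable D (EFin \o g) ->
  rsum D (fun t => f t + g t) = rsum D f + rsum D g.
Proof.
move=> sf sg.
have sf' := summable_max sf; have sg' := summable_max sg.
have sfN := summable_max (summable_oppr sf); have sgN := summable_max (summable_oppr sg).
rewrite (@eq_rsum _ _ _ (fun t => (Num.max (f t) 0 + Num.max (g t) 0) -
   (Num.max (- f t) 0 + Num.max (- g t) 0))); last first.
  by move=> t _; rewrite {1}(maxr_posneg (f t)) {1}(maxr_posneg (g t)); ring.
rewrite rsumB; first last.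
- exact: summable_addr sfN sgN.
- exact: summable_addr sf' sg'.
- by move=> t _; exact: addr_ge0.
- by move=> t _; exact: addr_ge0.
rewrite (esumDr (fun t _ => max0r_ge0 _) (fun t _ => max0r_ge0 _) sf' sg').
rewrite (esumDr (fun t _ => max0r_ge0 _) (fun t _ => max0r_ge0 _) sfN sgN).
by rewrite /rsum opprD addrACA.
Qed.

Lemma rsumN T (D : set T) (f : T -> R) : rsum D (fun t => - f t) = - rsum D f.
Proof. by rewrite /rsum opprB; under [X in _ - fine X]eq_esum do rewrite opprK. Qed.

Lemma fine_esumZ T (D : set T) (c : R) (f : T -> R) : 0 <= c ->
  (forall t, 0 <= f t) ->
  fine (\esum_(t in D) (c * f t)%:E) = c * fine (\esum_(t in D) (f t)%:E).
Proof.
move=> c0 f0; rewrite esumZl//; have [->|cn] := eqVneq c 0.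
  by rewrite mul0e mul0r.
have cp : (0 < c%:E)%E by rewrite lte_fin lt_neqAle eq_sym cn.
case: (esum _ _) => [r||] //=; first by rewrite gt0_muley//= mulr0.
by rewrite gt0_muleNy//= mulr0.
Qed.

Lemma rsumZ T (D : set T) (c : R) (f : T -> R) :
  rsum D (fun t => c * f t) = c * rsum D f.
Proof.
wlog c0 : c / 0 <= c => [hw|].
  have [|/ltW c0] := leP 0 c; first exact: hw.
  rewrite -[c]opprK mulNr -hw ?oppr_ge0// -rsumN.
  by apply: eq_rsum => t _; rewrite mulNr.
rewrite /rsum mulrBr -!fine_esumZ//; congr (fine _ - fine _);
  apply: eq_esum => t _; first by rewrite maxr_pMr// mulr0.
by rewrite maxr_pMr// mulr0 mulrN.
Qed.

Lemma rsum_le T (D : set T) (f : T -> R) : summable D (EFin \o f) ->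
  rsum D f <= fine (\esum_(t in D) (`|f t|)%:E).
Proof.
move=> sf; have sf' := summable_max sf; have sfN := summable_max (summable_oppr sf).
have H : 0 <= fine (\esum_(t in D) (Num.max (- f t) 0)%:E).
  by apply/fine_ge0/esum_ge0 => t _; rewrite lee_fin.
apply: (@le_trans _ _ (fine (\esum_(t in D) (Num.max (f t) 0)%:E))).
  by rewrite /rsum lerBlDr lerDl.
apply: fine_le; do ?exact: summable_fin.
  by apply: summable_fin => //; apply: le_summable sf => t _; rewrite normr_id.
by apply: le_esum => t _; rewrite lee_fin ge_max ler_norm normr_ge0.
Qed.

Lemma reindex_rsum (T T' : choiceType) (P : set T) (Q : set T') (e : T -> T')
    (a : T' -> R) : set_bij P Q e ->
  rsum Q a = rsum P (fun t => a (e t)).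
Proof. by move=> b; rewrite /rsum !(reindex_esum P Q e). Qed.

Lemma rsum_rsum (T1 T2 : choiceType) (I : set T1) (J : T1 -> set T2)
    (a : T1 -> T2 -> R) :
  summable (I `*`` J) (EFin \o (fun k => a k.1 k.2)) ->
  rsum I (fun i => rsum (J i) (a i)) = rsum (I `*`` J) (fun k => a k.1 k.2).
Proof.
move=> sa.
have ge0fin (b : T1 -> T2 -> R) : (forall i j, 0 <= b i j) ->
    summable (I `*`` J) (EFin \o (fun k => b k.1 k.2)) ->
    [/\ forall i, I i -> \esum_(j in J i) (b i j)%:E \is a fin_num,
      summable I (EFin \o (fun i => fine (\esum_(j in J i) (b i j)%:E))) &
      \esum_(i in I) (fine (\esum_(j in J i) (b i j)%:E))%:E =
      \esum_(k in I `*`` J) (b k.1 k.2)%:E].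
  move=> b0 sb.
  have E := @esum_esum R T1 T2 I J (fun i j => (b i j)%:E)
    (fun i j _ _ => b0 i j).
  have F : summable I (fun i => \esum_(j in J i) (b i j)%:E).
    rewrite /summable (_ : esum _ _ = \esum_(i in I) \esum_(j in J i) (b i j)%:E).
      rewrite E; move: sb; apply: le_lt_trans; apply: le_esum => k _ /=.
      by rewrite lee_fin ler_norm.
    by apply: eq_esum => i Ii; rewrite gee0_abs// esum_ge0// => j _; rewrite lee_fin.
  have G i : I i -> \esum_(j in J i) (b i j)%:E \is a fin_num.
    by move=> Ii; rewrite fin_num_abs (summable_pinfty F).
  split => //.
    move: F; apply: le_lt_trans; apply: le_esum => i Ii /=.
    by rewrite -[X in (_ <= `|X|)%E]fineK ?G.
  by rewrite -E; apply: eq_esum => i Ii; rewrite fineK ?G.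
have [p1 p2 p3] := ge0fin (fun i j => Num.max (a i j) 0) (fun i j => max0r_ge0 _) (summable_max sa).
have [n1 n2 n3] := ge0fin (fun i j => Num.max (- a i j) 0) (fun i j => max0r_ge0 _)
   (summable_max (summable_oppr sa)).
rewrite /rsum -/(rsum I _) rsumB//; last 2 first.
  by move=> i _; apply/fine_ge0/esum_ge0 => j _; rewrite lee_fin.
  by move=> i _; apply/fine_ge0/esum_ge0 => j _; rewrite lee_fin.
by rewrite p3 n3.
Qed.

Lemma rsum_single T (D : set T) (f : T -> R) (t0 : T) : D t0 ->
  (forall t, D t -> t != t0 -> f t = 0) -> rsum D f = f t0.
Proof.
move=> Dt0 f0.
have E (g : T -> R) : (forall t, 0 <= g t) -> (forall t, D t -> t != t0 -> g t = 0) ->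
    \esum_(t in D) (g t)%:E = (g t0)%:E.
  move=> g0 g1; rewrite (esumID [set t0]); last by move=> t _; rewrite lee_fin.
  rewrite setI1 mem_set// esum_set1 ?lee_fin//.
  rewrite esum1 ?adde0// => t [Dt /eqP tt0]; by rewrite g1.
rewrite /rsum !E//=; last 2 first.
- by move=> t Dt tt0; rewrite f0// oppr0 maxxx.
- by move=> t Dt tt0; rewrite f0// maxxx.
by rewrite -maxr_posneg.
Qed.

Lemma rsum0 T (D : set T) (f : T -> R) : (forall t, D t -> f t = 0) -> rsum D f = 0.
Proof.
by move=> f0; rewrite /rsum !esum1 ?subrr// => t Dt; rewrite f0// ?oppr0 maxxx.
Qed.

End RealSum.

Section ComplexSum.
Context (R : realType).
Implicit Types (T : choiceType).

Definition csum T (D : set T) (h : T -> R[i]) : R[i] :=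
  Complex (rsum D (fun t => Re (h t))) (rsum D (fun t => Im (h t))).

Definition csummable T (D : set T) (h : T -> R[i]) : Prop :=
  (\esum_(t in D) (normc (h t))%:E < +oo)%E.

Lemma normr_normc (z : R[i]) : `|z| = (normc z)%:C%C. Proof. by []. Qed.

Lemma Re_normr (z : R[i]) : Re `|z| = normc z. Proof. by []. Qed.

Lemma normc_ge0 (z : R[i]) : 0 <= normc z.
Proof. by case: z => a b; exact: sqrtr_ge0. Qed.
Hint Resolve normc_ge0 : core.

Lemma normc_triangle (x y : R[i]) : normc (x + y) <= normc x + normc y.
Proof. by have := ler_normD x y; rewrite !normr_normc lecE => /andP[_]. Qed.

Lemma Re_le_normc (z : R[i]) : `|Re z| <= normc z.
Proof.
case: z => a b /=; rewrite -[`|a|]sqrtr_sqr ler_sqrt; first by rewrite lerDl sqr_ge0.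
by rewrite addr_ge0// sqr_ge0.
Qed.

Lemma Im_le_normc (z : R[i]) : `|Im z| <= normc z.
Proof.
case: z => a b /=; rewrite -[`|b|]sqrtr_sqr ler_sqrt; first by rewrite lerDr sqr_ge0.
by rewrite addr_ge0// sqr_ge0.
Qed.

Lemma normc_le_ReIm (z : R[i]) : normc z <= `|Re z| + `|Im z|.
Proof.
case: z => a b; have := normc_triangle (Complex a 0) (Complex 0 b).
rewrite /= /Normc.normc /= !(addr0, add0r, expr0n) /=.
by rewrite !sqrtr_sqr.
Qed.

Lemma csummable_le T (D : set T) (f : T -> R[i]) (g : T -> R) :
  (forall t, D t -> normc (f t) <= g t) ->
  (\esum_(t in D) (g t)%:E < +oo)%E -> csummable D f.
Proof.
move=> fg; apply: le_lt_trans; apply: le_esum => t Dt; rewrite lee_fin; exact: fg.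
Qed.

Lemma csummable_Re T (D : set T) h : csummable D h ->
  summable D (EFin \o (fun t => Re (h t))).
Proof.
by apply: le_lt_trans; apply: le_esum => t _ /=; rewrite lee_fin Re_le_normc.
Qed.

Lemma csummable_Im T (D : set T) h : csummable D h ->
  summable D (EFin \o (fun t => Im (h t))).
Proof.
by apply: le_lt_trans; apply: le_esum => t _ /=; rewrite lee_fin Im_le_normc.
Qed.

Lemma eq_csum T (D : set T) (f g : T -> R[i]) :
  (forall t, D t -> f t = g t) -> csum D f = csum D g.
Proof. by move=> fg; congr Complex; apply: eq_rsum => t Dt; rewrite fg. Qed.

Lemma csumD T (D : set T) (f g : T -> R[i]) : csummable D f -> csummable D g ->
  csum D (fun t => f t + g t) = csum D f + csum D g.
Proof.
move=> sf sg; rewrite /csum.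
rewrite (@eq_rsum _ _ _ _ (fun t => Re (f t) + Re (g t))); last first.
  by move=> t _; case: (f t) (g t) => [? ?] [? ?].
rewrite (@eq_rsum _ _ _ (fun t => Im _) (fun t => Im (f t) + Im (g t))); last first.
  by move=> t _; case: (f t) (g t) => [? ?] [? ?].
by rewrite (rsumD (csummable_Re sf) (csummable_Re sg))
  (rsumD (csummable_Im sf) (csummable_Im sg)).
Qed.

Lemma csumZ T (D : set T) (c : R[i]) (f : T -> R[i]) : csummable D f ->
  csum D (fun t => c * f t) = c * csum D f.
Proof.
move=> sf; have sr := csummable_Re sf; have si := csummable_Im sf.
have sZ (k : R) (h : T -> R) : summable D (EFin \o h) ->
    summable D (EFin \o (fun t => k * h t)).
  move=> sh; rewrite summableEFin; under eq_esum do rewrite normrM.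
  by rewrite esumZl// lte_mul_pinfty// lee_fin.
case: c => a b; rewrite /csum.
rewrite (@eq_rsum _ _ _ _ (fun t => a * Re (f t) + (- b) * Im (f t))); last first.
  by move=> t _; case: (f t) => [? ?] /=; rewrite mulNr.
rewrite (@eq_rsum _ _ _ (fun t => Im _) (fun t => a * Im (f t) + b * Re (f t))); last first.
  by move=> t _; case: (f t) => [? ?] /=.
rewrite (rsumD (sZ a _ sr) (sZ (- b) _ si)) (rsumD (sZ a _ si) (sZ b _ sr)).
by rewrite !rsumZ mulNr.
Qed.

Lemma csum_csum (T1 T2 : choiceType) (I : set T1) (J : T1 -> set T2)
    (a : T1 -> T2 -> R[i]) :
  csummable (I `*`` J) (fun k => a k.1 k.2) ->
  csum I (fun i => csum (J i) (a i)) = csum (I `*`` J) (fun k => a k.1 k.2).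
Proof.
move=> sa; rewrite /csum/=; congr Complex.
  by rewrite (rsum_rsum (a := fun i j => Re (a i j)))//; exact: csummable_Re sa.
by rewrite (rsum_rsum (a := fun i j => Im (a i j)))//; exact: csummable_Im sa.
Qed.

Lemma reindex_csum (T T' : choiceType) (P : set T) (Q : set T') (e : T -> T')
    (a : T' -> R[i]) : set_bij P Q e ->
  csum Q a = csum P (fun t => a (e t)).
Proof. by move=> b; rewrite /csum !(reindex_rsum _ b). Qed.

Lemma csum_single T (D : set T) (f : T -> R[i]) (t0 : T) : D t0 ->
  (forall t, D t -> t != t0 -> f t = 0) -> csum D f = f t0.
Proof.
move=> Dt0 f0; rewrite /csum !(rsum_single Dt0); first by case: (f t0).
by move=> t Dt /(f0 _ Dt) ->.
by move=> t Dt /(f0 _ Dt) ->.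
Qed.

Lemma csum0 T (D : set T) (f : T -> R[i]) :
  (forall t, D t -> f t = 0) -> csum D f = 0.
Proof.
by move=> f0; rewrite /csum !rsum0// => t Dt; rewrite f0.
Qed.

Lemma normc_csum_le T (D : set T) (f : T -> R[i]) : csummable D f ->
  ((normc (csum D f))%:E <= \esum_(t in D) (normc (f t))%:E)%E.
Proof.
move=> sf; set z := csum D f.
have [z0|z0] := eqVneq z 0.
  by rewrite z0 -Re_normr normr0; apply: esum_ge0 => t _; rewrite lee_fin.
pose c : R[i] := `|z| / z.
have nc : normc c = 1.
  by rewrite -Re_normr normrM normr_id normfV divff// normr_eq0.
have sfin : \esum_(t in D) (normc (f t))%:E \is a fin_num.
  by rewrite ge0_fin_numE// esum_ge0// => t _; rewrite lee_fin.
have -> : normc z = rsum D (fun t => Re (c * f t)).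
  by rewrite -[RHS]/(Re (csum D (fun t => c * f t))) csumZ// -/z mulfVK.
have sc : csummable D (fun t => c * f t).
  by apply: csummable_le sf => t _; rewrite Normc.normcM nc mul1r.
rewrite -[leRHS]fineK// lee_fin (le_trans (rsum_le (csummable_Re sc)))//.
have le : (\esum_(t in D) (`|Re (c * f t)|)%:E <= \esum_(t in D) (normc (f t))%:E)%E.
  apply: le_esum => t _; rewrite lee_fin (le_trans (Re_le_normc _))//.
  by rewrite Normc.normcM nc mul1r.
apply: fine_le => //; rewrite ge0_fin_numE; last first.
  by apply: esum_ge0 => t _; rewrite lee_fin.
by rewrite (le_lt_trans le)// -ge0_fin_numE// esum_ge0// => t _; rewrite lee_fin.
Qed.

Lemma esum_prod T1 T2 (f : T1 -> R) (g : T2 -> R) :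
  (forall s, 0 <= f s) -> (forall t, 0 <= g t) ->
  (\esum_(t in setT) (g t)%:E < +oo)%E ->
  (\esum_(p in [set: T1 * T2]) (f p.1 * g p.2)%:E =
   (\esum_(s in setT) (f s)%:E) * (\esum_(t in setT) (g t)%:E))%E.
Proof.
move=> f0 g0 sg.
have -> : [set: T1 * T2] = [set: T1] `*`` (fun=> [set: T2]) by apply/seteqP; split.
rewrite -(@esum_esum _ _ _ _ _ (fun s t => (f s * g t)%:E)); last first.
  by move=> s t _ _; rewrite lee_fin mulr_ge0.
have gfin : \esum_(t in setT) (g t)%:E \is a fin_num.
  by rewrite ge0_fin_numE// esum_ge0// => t _; rewrite lee_fin.
rewrite -(fineK gfin) muleC -esumZl//; last first.
  by apply/fine_ge0/esum_ge0 => t _; rewrite lee_fin.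
by apply: eq_esum => s _; rewrite esumZl// EFinM fineK// muleC.
Qed.

Lemma esum_subset (T : choiceType) (D E : set T) (a : T -> R) : D `<=` E ->
  (forall t, 0 <= a t) ->
  (\esum_(t in D) (a t)%:E <= \esum_(t in E) (a t)%:E)%E.
Proof.
move=> DE a0; rewrite (esumID D E); last by move=> t _; rewrite lee_fin.
rewrite (_ : E `&` D = D); last by rewrite setIC; apply/setIidl.
by rewrite leeDl// esum_ge0// => t _; rewrite lee_fin.
Qed.

End ComplexSum.

#[local] Hint Extern 0 (is_true (@Order.le _ _ _ (Normc.normc _))) =>
  exact: normc_ge0 : core.

Section RealComplete.
Import numFieldNormedType.Exports.

Lemma real_cauchy_cvg (R : realType) (x : nat -> R) :
  (forall e : R, 0 < e -> exists N, forall m n, (N <= m)%N -> (N <= n)%N ->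
     `|x m - x n| < e) ->
  exists l, forall e : R, 0 < e -> exists N, forall n, (N <= n)%N -> `|x n - l| < e.
Proof.
move=> cx; have /cauchy_cvgP/cvg_ex[l /cvgrPdist_lt xl] : cauchy (x @ \oo).
  apply/cauchyP => e /cx[N hN]; exists (x N).
  by exists N => // n /= Nn; rewrite /ball_/=; exact: hN.
exists l => e /xl[N _ hN]; exists N => n /hN /=.
by rewrite distrC.
Qed.

End RealComplete.

(* The last axiom excludes the one-element monoid, for which delta_1 would not
   be a function on S minus its zero. *)
HB.mixin Record Monoid_hasZero S of monoid.Monoid S := {
  zerog : S;
  mul0g : left_zero zerog (@mul S);
  mulg0 : right_zero zerog (@mul S);
  oneg_neq0 : (1%g : S) != zerog
}.

#[short(type="zeroMonoidType")]
HB.structure Definition ZeroMonoid := {S of Monoid_hasZero S & monoid.Monoid S}.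

Definition nonzero (S : zeroMonoidType) := {s : S | s != zerog}.

Definition is_weight (R : realType) (S : monoidType) (w : S -> R) : Prop :=
  [/\ forall s, 0 < w s,
      forall s t, w (s * t)%g <= w s * w t &
      w 1%g = 1].

Record quasi_weight (R : realType) (S : zeroMonoidType) := QuasiWeight {
  qweight :> nonzero S -> R;
  quasi_weightP :
    exists2 w : S -> R, is_weight w & forall s, qweight s = w (val s)
}.

Section Ell1.
Context (R : realType) (S : zeroMonoidType) (mu : quasi_weight R S).
Local Notation X := (nonzero S).
Implicit Types (s t u : X).

Lemma qw_gt0 s : 0 < mu s.
Proof. by have [w [w0 _ _] ->] := quasi_weightP mu. Qed.
#[local] Hint Extern 0 (is_true (@Order.lt _ _ _ (qweight _ _))) => exact: qw_gt0 : core.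

Lemma qw_ge0 s : 0 <= mu s. Proof. exact: ltW. Qed.
#[local] Hint Extern 0 (is_true (@Order.le _ _ _ (qweight _ _))) => exact: qw_ge0 : core.

Lemma qwM s t u : (val s * val t)%g = val u -> mu u <= mu s * mu t.
Proof. by have [w [_ wM _] e] := quasi_weightP mu; rewrite !e => <-. Qed.

Definition one_nz : X := exist _ 1%g oneg_neq0.

Lemma qw1 : mu one_nz = 1.
Proof. by have [w [_ _ w1] ->] := quasi_weightP mu. Qed.

Definition ell1_pred : {pred X -> R[i]^o} :=
  [pred f : X -> R[i]^o | \esum_(s in setT) (normc (f s) * mu s)%:E < +oo]%E.

Record ell1_space := Ell1 { ell1_fun :> X -> R[i]^o; _ : ell1_fun \in ell1_pred }.

HB.instance Definition _ := [isSub of ell1_space for ell1_fun].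
HB.instance Definition _ := [Choice of ell1_space by <:].

Lemma ell1P (f : ell1_space) : (\esum_(s in setT) (normc (f s) * mu s)%:E < +oo)%E.
Proof. by case: f. Qed.

Lemma ell1_submod_closed : submod_closed ell1_pred.
Proof.
split => [|a f g]; rewrite !inE /=.
  rewrite esum1 ?ltry// => s _; transitivity ((0 * mu s)%:E); last by rewrite mul0r.
  by congr (_ * _)%:E; exact: Normc.normc0.
move=> sf sg; apply: (@le_lt_trans _ _ (\esum_(s in setT) (normc a * (normc (f s) * mu s))%:E +
   \esum_(s in setT) (normc (g s) * mu s)%:E)%E).
  rewrite -esumD; last 2 first.
  - by move=> s _; rewrite lee_fin !mulr_ge0.
  - by move=> s _; rewrite lee_fin !mulr_ge0.
  apply: le_esum => s _; rewrite lee_fin mulrA -mulrDl ler_wpM2r//.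
  by rewrite (le_trans (normc_triangle _ _))// Normc.normcM.
rewrite esumZl//; last by move=> s _; rewrite mulr_ge0.
by apply: lte_add_pinfty => //; apply: lte_mul_pinfty; rewrite ?lee_fin.
Qed.

HB.instance Definition _ :=
  GRing.isSubmodClosed.Build R[i] (X -> R[i]^o) ell1_pred ell1_submod_closed.
HB.instance Definition _ := [SubChoice_isSubLmodule of ell1_space by <:].

Lemma ell1_eqP (f g : ell1_space) : f =1 g -> f = g.
Proof. by move=> fg; apply/val_inj/funext. Qed.

Definition ell1_norm (f : ell1_space) : R :=
  fine (\esum_(s in setT) (normc (f s) * mu s)%:E).

Lemma ell1_normE (f : ell1_space) :
  (\esum_(s in setT) (normc (f s) * mu s)%:E = (ell1_norm f)%:E)%E.
Proof.
rewrite fineK// ge0_fin_numE ?ell1P//.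
by apply: esum_ge0 => s _; rewrite lee_fin mulr_ge0.
Qed.

Lemma ell1_norm_ge0 (f : ell1_space) : 0 <= ell1_norm f.
Proof. by apply/fine_ge0/esum_ge0 => s _; rewrite lee_fin mulr_ge0. Qed.

Lemma ell1_norm_ge (f : ell1_space) s : normc (f s) * mu s <= ell1_norm f.
Proof.
rewrite -lee_fin -ell1_normE -(esum_set1 (a := fun s => (normc (f s) * mu s)%:E)).
  by apply: esum_ge; exists [set s] => //; rewrite esum_fset// => t _; rewrite lee_fin mulr_ge0.
by rewrite lee_fin mulr_ge0.
Qed.

Lemma ell1_norm_eq0 (f : ell1_space) : ell1_norm f = 0 -> f = 0.
Proof.
move=> f0; apply: ell1_eqP => s.
have := ell1_norm_ge f s; rewrite f0 pmulr_lle0// => n0.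
by apply/Normc.eq0_normc/eqP; rewrite eq_le n0 normc_ge0.
Qed.

Lemma ell1_normD (f g : ell1_space) : ell1_norm (f + g) <= ell1_norm f + ell1_norm g.
Proof.
rewrite -lee_fin EFinD -!ell1_normE -esumD; last 2 first.
- by move=> s _; rewrite lee_fin mulr_ge0.
- by move=> s _; rewrite lee_fin mulr_ge0.
by apply: le_esum => s _; rewrite -EFinD lee_fin -mulrDl ler_wpM2r ?normc_triangle.
Qed.

Lemma ell1_normZ (c : R[i]) (f : ell1_space) : ell1_norm (c *: f) = normc c * ell1_norm f.
Proof.
apply: EFin_inj; rewrite EFinM -!ell1_normE -esumZl//; last first.
  by move=> s _; rewrite mulr_ge0.
by apply: eq_esum => s _; rewrite mulrA -Normc.normcM.
Qed.

(* (f # g)(u) is the sum of f(s) g(t) over s t = u; pairs with s t = 0 do not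
   contribute. See ell1_deltaM and ell1_deltaM0 for the values on point masses
   and ell1_normM for boundedness. *)
Definition factorizations u : set (X * X) :=
  [set p | (val p.1 * val p.2)%g = val u].

Definition ell1_conv (f g : X -> R[i]) u : R[i] :=
  csum (factorizations u) (fun p => f p.1 * g p.2).

Let A := ell1_space.

Lemma esum_ell1_pair (f g : A) :
  (\esum_(p in [set: X * X]) ((normc (f p.1) * mu p.1) * (normc (g p.2) * mu p.2))%:E
   = (ell1_norm f * ell1_norm g)%:E)%E.
Proof.
rewrite EFinM -!ell1_normE; apply: (esum_prod (f := fun s => normc (f s) * mu s)
  (g := fun s => normc (g s) * mu s)).
- by move=> s; rewrite mulr_ge0.
- by move=> s; rewrite mulr_ge0.
- exact: ell1P.
Qed.

Lemma csummable_ell1_conv (f g : A) u :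
  csummable (factorizations u) (fun p => f p.1 * g p.2).
Proof.
pose a (p : X * X) := (mu u)^-1 * ((normc (f p.1) * mu p.1) * (normc (g p.2) * mu p.2)).
have a0 p : 0 <= (normc (f p.1) * mu p.1) * (normc (g p.2) * mu p.2).
  by rewrite !mulr_ge0.
apply: (@csummable_le _ _ _ _ a) => [p Dp|].
  rewrite /a ler_pdivlMl// Normc.normcM mulrACA mulrC ler_wpM2l//.
    by rewrite mulr_ge0.
  exact: qwM.
rewrite /a esumZl ?invr_ge0//; apply: lte_mul_pinfty; rewrite ?lee_fin ?invr_ge0//.
rewrite (le_lt_trans (esum_subset (@subsetT _ _) a0))//.
by rewrite esum_ell1_pair ltry.
Qed.

Lemma esum_ell1_conv (f g : A) :
  (\esum_(u in setT) (normc (ell1_conv f g u) * mu u)%:E <=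
   (ell1_norm f * ell1_norm g)%:E)%E.
Proof.
pose a (p : X * X) := ((normc (f p.1) * mu p.1) * (normc (g p.2) * mu p.2)).
have a0 p : 0 <= a p by rewrite /a !mulr_ge0.
apply: (@le_trans _ _ (\esum_(u in setT) \esum_(p in factorizations u) (a p)%:E)%E).
  apply: le_esum => u _; rewrite mulrC EFinM.
  apply: le_trans (lee_wpmul2l _ (normc_csum_le (csummable_ell1_conv f g u))) _.
    by rewrite lee_fin.
  rewrite -esumZl//; apply: le_esum => p Dp; rewrite lee_fin /a.
  rewrite Normc.normcM mulrACA mulrC ler_wpM2l// ?mulr_ge0//; exact: qwM.
rewrite esum_esum; last by move=> u p _ _; rewrite lee_fin.
rewrite -esum_ell1_pair -/a.
rewrite -(@esum_image _ _ _ _ (fun k : X * (X * X) => k.2) (fun p => (a p)%:E)).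
  exact: esum_subset.
move=> [u p] [v q] /[!inE] -[/= _ +] [/= _ +] pq; rewrite pq /factorizations/= => -> uv.
by congr pair; apply/val_inj.
Qed.

Lemma ell1_mul_subproof (f g : A) : (ell1_conv f g : X -> R[i]^o) \in ell1_pred.
Proof. by rewrite inE /= (le_lt_trans (esum_ell1_conv f g))// ltry. Qed.

Definition ell1_mul (f g : A) : A := Ell1 (ell1_mul_subproof f g).

Lemma ell1_mulE (f g : A) u :
  ell1_mul f g u = csum (factorizations u) (fun p => f p.1 * g p.2).
Proof. by []. Qed.

Lemma ell1_normM (f g : A) : ell1_norm (ell1_mul f g) <= ell1_norm f * ell1_norm g.
Proof. by rewrite -lee_fin -ell1_normE esum_ell1_conv. Qed.

Definition ell1_delta_fun s : X -> R[i]^o := fun t => (t == s)%:R.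

Lemma esum_ell1_delta s : (\esum_(t in setT) (normc (ell1_delta_fun s t) * mu t)%:E = (mu s)%:E)%E.
Proof.
rewrite (esumID [set s]); last by move=> t _; rewrite lee_fin mulr_ge0.
rewrite setI1 mem_set// esum_set1 ?lee_fin ?mulr_ge0//.
rewrite /ell1_delta_fun eqxx Normc.normc1 mul1r esum1 ?adde0// => t [_ /eqP/negbTE ts].
by rewrite ts Normc.normc0 mul0r.
Qed.

Lemma ell1_delta_subproof s : ell1_delta_fun s \in ell1_pred.
Proof. by rewrite inE /= esum_ell1_delta ltry. Qed.

Definition ell1_delta s : A := Ell1 (ell1_delta_subproof s).

Lemma ell1_norm_delta s : ell1_norm (ell1_delta s) = mu s.
Proof. by rewrite /ell1_norm esum_ell1_delta. Qed.

Lemma ell1_deltaM s t u : (val s * val t)%g = val u ->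
  ell1_mul (ell1_delta s) (ell1_delta t) = ell1_delta u.
Proof.
move=> stu; apply: ell1_eqP => v; rewrite ell1_mulE.
have [vu|vu] := eqVneq v u.
  rewrite (@csum_single _ _ _ _ (s, t)).
  - by rewrite /= /ell1_delta_fun vu !eqxx mulr1.
  - by rewrite /factorizations/= vu.
  - move=> [a b] _; rewrite /= /ell1_delta_fun xpair_eqE.
    by case: (a == s); case: (b == t); rewrite ?mul0r ?mulr0.
rewrite /= /ell1_delta_fun (negbTE vu) csum0// => -[a b] /= ab.
have [e1|] := eqVneq a s; have [e2|] := eqVneq b t; rewrite ?mul0r ?mulr0//.
by move: ab vu; rewrite /factorizations/= e1 e2 stu => /val_inj ->; rewrite eqxx.
Qed.

Lemma ell1_deltaM0 s t : (val s * val t)%g = zerog ->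
  ell1_mul (ell1_delta s) (ell1_delta t) = 0.
Proof.
move=> st0; apply: ell1_eqP => v; rewrite ell1_mulE csum0// => -[a b] /= ab.
rewrite /ell1_delta_fun.
have [e1|] := eqVneq a s; have [e2|] := eqVneq b t; rewrite ?mul0r ?mulr0//.
by move: ab (valP v); rewrite /factorizations/= e1 e2 st0 => <-; rewrite eqxx.
Qed.

Lemma ell1_mul1l : left_id (ell1_delta one_nz) ell1_mul.
Proof.
move=> f; apply: ell1_eqP => u; rewrite ell1_mulE.
rewrite (@csum_single _ _ _ _ (one_nz, u)).
- by rewrite /= /ell1_delta_fun eqxx mul1r.
- by rewrite /factorizations/= mul1g.
- move=> [a b]; rewrite /factorizations/= /ell1_delta_fun xpair_eqE => ab.
  have [e|] := eqVneq a one_nz; rewrite ?mul0r//.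
  by move: ab; rewrite e /= mul1g => /val_inj ->; rewrite eqxx.
Qed.

Lemma ell1_mul1r : right_id (ell1_delta one_nz) ell1_mul.
Proof.
move=> f; apply: ell1_eqP => u; rewrite ell1_mulE.
rewrite (@csum_single _ _ _ _ (u, one_nz)).
- by rewrite /= /ell1_delta_fun eqxx mulr1.
- by rewrite /factorizations/= mulg1.
- move=> [a b]; rewrite /factorizations/= /ell1_delta_fun xpair_eqE andbC => ab.
  have [e|] := eqVneq b one_nz; rewrite ?mulr0//.
  by move: ab; rewrite e /= mulg1 => /val_inj ->; rewrite eqxx.
Qed.

Lemma ell1_mulDl : left_distributive ell1_mul +%R.
Proof.
move=> f g h; apply: ell1_eqP => u.
apply: etrans (csumD (csummable_ell1_conv f h u) (csummable_ell1_conv g h u)).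
by rewrite ell1_mulE; apply: eq_csum => p _; rewrite -mulrDl.
Qed.

Lemma ell1_mulDr : right_distributive ell1_mul +%R.
Proof.
move=> f g h; apply: ell1_eqP => u.
apply: etrans (csumD (csummable_ell1_conv f g u) (csummable_ell1_conv f h u)).
by rewrite ell1_mulE; apply: eq_csum => p _; rewrite -mulrDr.
Qed.

Lemma ell1_scaleAl (c : R[i]) (f g : A) : c *: ell1_mul f g = ell1_mul (c *: f) g.
Proof.
apply: ell1_eqP => u; apply: etrans (esym (csumZ c (csummable_ell1_conv f g u))) _.
by rewrite ell1_mulE; apply: eq_csum => p _; rewrite mulrA.
Qed.

Lemma ell1_scaleAr (c : R[i]) (f g : A) : c *: ell1_mul f g = ell1_mul f (c *: g).
Proof.
apply: ell1_eqP => u; apply: etrans (esym (csumZ c (csummable_ell1_conv f g u))) _.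
by rewrite ell1_mulE; apply: eq_csum => p _; rewrite mulrCA.
Qed.

Definition ell1_triples u : set (X * X * X) :=
  [set k | (val k.1.1 * val k.1.2 * val k.2)%g = val u].

Lemma csummable_ell1_triples (f g h : A) u :
  csummable (ell1_triples u) (fun k => f k.1.1 * g k.1.2 * h k.2).
Proof.
pose a (k : X * X * X) := ((normc (f k.1.1) * mu k.1.1) * (normc (g k.1.2) * mu k.1.2)) *
   (normc (h k.2) * mu k.2).
have a0 p : 0 <= a p by rewrite /a !mulr_ge0.
apply: (@csummable_le _ _ _ _ (fun k => (mu u)^-1 * a k)) => [k Dk|].
  rewrite ler_pdivlMl// !Normc.normcM /a.
  rewrite [leRHS](_ : _ = (normc (f k.1.1) * normc (g k.1.2) * normc (h k.2)) *
    (mu k.1.1 * mu k.1.2 * mu k.2)); last by ring.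
  rewrite mulrC ler_wpM2l ?mulr_ge0//.
  have Dk' : (val k.1.1 * val k.1.2 * val k.2)%g = val u := Dk.
  have [w [w0 wM _] e] := quasi_weightP mu; rewrite !e -Dk'.
  by rewrite (le_trans (wM _ _))// ler_wpM2r// ltW.
rewrite esumZl ?invr_ge0//; apply: lte_mul_pinfty; rewrite ?lee_fin ?invr_ge0//.
rewrite (le_lt_trans (esum_subset (@subsetT _ _) a0))//.
rewrite (esum_prod (f := fun p : X * X => (normc (f p.1) * mu p.1) * (normc (g p.2) * mu p.2))
  (g := fun s => normc (h s) * mu s)).
- by rewrite esum_ell1_pair ell1_normE -EFinM ltry.
- by move=> s; rewrite !mulr_ge0.
- by move=> s; rewrite mulr_ge0.
- exact: ell1P.
Qed.

Definition mulnz s t : X := insubd one_nz (val s * val t)%g.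

Lemma mulnzE s t : (val s * val t)%g != zerog -> val (mulnz s t) = (val s * val t)%g.
Proof. by move=> st; rewrite /mulnz insubdK. Qed.

Lemma ell1_triples_nz u (k : X * X * X) : ell1_triples u k ->
  (val k.1.1 * val k.1.2)%g != zerog /\ (val k.1.2 * val k.2)%g != zerog.
Proof.
move=> Dk; have e : (val k.1.1 * val k.1.2 * val k.2)%g = val u := Dk.
have := valP u; rewrite -e => nz.
split; apply: contraNneq nz => st0; first by rewrite st0 mul0g.
by rewrite -mulgA st0 mulg0.
Qed.

Lemma csum_ell1_triplesl (f g h : A) u :
  ell1_mul (ell1_mul f g) h u =
  csum (ell1_triples u) (fun k => f k.1.1 * g k.1.2 * h k.2).
Proof.
pose e (k : X * X * X) := ((mulnz k.1.1 k.1.2, k.2), k.1).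
have b : set_bij (ell1_triples u) (factorizations u `*`` (fun p => factorizations p.1)) e.
  split.
  - move=> k Dk; have [k1 k2] := ell1_triples_nz Dk.
    by rewrite /e /factorizations/= !mulnzE.
  - by move=> [x y] [x' y'] _ _ [_ -> ->].
  - move=> [[p w] q] [/= e1 e2].
    have Dk : ell1_triples u (q, w) by rewrite /ell1_triples/= e2 e1.
    exists (q, w) => //; congr (_, _, _); apply: val_inj.
    by rewrite mulnzE//=; have [] := ell1_triples_nz Dk.
pose F (k : (X * X) * (X * X)) := f k.2.1 * g k.2.2 * h k.1.2.
have sF : csummable (factorizations u `*`` (fun p => factorizations p.1)) F.
  by rewrite /csummable (reindex_esum _ _ _ _ b); exact: csummable_ell1_triples.
rewrite [RHS](_ : _ = csum (ell1_triples u) (fun k => F (e k)))//.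
rewrite -(reindex_csum F b).
rewrite -(csum_csum (a := fun p q => F (p, q))); last first.
  by move: sF; rewrite /csummable; congr (_ < +oo)%E; apply: eq_esum => -[].
rewrite ell1_mulE; apply: eq_csum => p _.
rewrite [X in X * _]ell1_mulE mulrC -csumZ; last exact: csummable_ell1_conv.
by apply: eq_csum => q _; rewrite mulrC.
Qed.

Lemma csum_ell1_triplesr (f g h : A) u :
  ell1_mul f (ell1_mul g h) u =
  csum (ell1_triples u) (fun k => f k.1.1 * g k.1.2 * h k.2).
Proof.
pose e (k : X * X * X) := ((k.1.1, mulnz k.1.2 k.2), (k.1.2, k.2)).
have b : set_bij (ell1_triples u) (factorizations u `*`` (fun p => factorizations p.2)) e.
  split.
  - move=> k Dk; have [k1 k2] := ell1_triples_nz Dk.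
    by rewrite /e /factorizations/= !mulnzE// mulgA.
  - by move=> [[x y] z] [[x' y'] z'] _ _ [-> _ -> ->].
  - move=> [[p w] [q q']] [/= e1 e2].
    have Dk : ell1_triples u (p, q, q').
      by move: e1 e2; rewrite /ell1_triples /factorizations/= -mulgA => + ->.
    exists (p, q, q') => //; congr (_, _, _); apply: val_inj.
    by rewrite mulnzE//=; have [] := ell1_triples_nz Dk.
pose F (k : (X * X) * (X * X)) := f k.1.1 * g k.2.1 * h k.2.2.
have sF : csummable (factorizations u `*`` (fun p => factorizations p.2)) F.
  by rewrite /csummable (reindex_esum _ _ _ _ b); exact: csummable_ell1_triples.
rewrite [RHS](_ : _ = csum (ell1_triples u) (fun k => F (e k)))//.
rewrite -(reindex_csum F b).
rewrite -(csum_csum (a := fun p q => F (p, q))); last first.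
  by move: sF; rewrite /csummable; congr (_ < +oo)%E; apply: eq_esum => -[].
rewrite ell1_mulE; apply: eq_csum => p _.
rewrite [X in _ * X]ell1_mulE -csumZ; last exact: csummable_ell1_conv.
by apply: eq_csum => q _; rewrite mulrA.
Qed.

Lemma ell1_mulA : associative ell1_mul.
Proof.
by move=> f g h; apply: ell1_eqP => u; rewrite csum_ell1_triplesl csum_ell1_triplesr.
Qed.

Lemma ell1_delta1_neq0 : ell1_delta one_nz != 0.
Proof.
apply/eqP => /(congr1 (fun f : A => f one_nz)) /=.
by rewrite /ell1_delta_fun eqxx => /eqP; rewrite oner_eq0.
Qed.

HB.instance Definition _ := GRing.Zmodule_isNzRing.Build ell1_space
  ell1_mulA ell1_mul1l ell1_mul1r ell1_mulDl ell1_mulDr ell1_delta1_neq0.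
HB.instance Definition _ :=
  GRing.Lmodule_isLalgebra.Build R[i] ell1_space ell1_scaleAl.
HB.instance Definition _ :=
  GRing.Lalgebra_isAlgebra.Build R[i] ell1_space ell1_scaleAr.

Lemma ell1_complete (f : nat -> A) :
  (forall e : R, 0 < e -> exists N, forall m n, (N <= m)%N -> (N <= n)%N ->
     ell1_norm (f m - f n) < e) ->
  exists l, forall e : R, 0 < e -> exists N, forall n, (N <= n)%N ->
     ell1_norm (f n - l) < e.
Proof.
move=> cf.
have cfs (P : R[i] -> R) : (forall z, `|P z| <= normc z) ->
    (forall y z, P (y - z) = P y - P z) -> forall s,
    exists l, forall e : R, 0 < e -> exists N, forall n, (N <= n)%N -> `|P (f n s) - l| < e.
  move=> Pn PB s; apply: real_cauchy_cvg => e e0.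
  have [N hN] := cf (e * mu s) (mulr_gt0 e0 (qw_gt0 s)).
  exists N => m n Nm Nn; rewrite -PB (le_lt_trans (Pn _))//.
  by rewrite -(ltr_pM2r (qw_gt0 s)) (le_lt_trans _ (hN m n Nm Nn))// (ell1_norm_ge (f m - f n)).
have [a fa] := choice (cfs Re (@Re_le_normc R) (fun y z => ltac:(by case: y z => ? ? [? ?]))).
have [b fb] := choice (cfs Im (@Im_le_normc R) (fun y z => ltac:(by case: y z => ? ? [? ?]))).
pose g : X -> R[i]^o := fun s => Complex (a s) (b s).
have fg s e : 0 < e -> exists N, forall n, (N <= n)%N -> normc (f n s - g s) < e.
  move=> e0; have [N hN] := fa s _ (divr_gt0 e0 (ltr0n _ 2)).
  have [M hM] := fb s _ (divr_gt0 e0 (ltr0n _ 2)).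
  exists (maxn N M) => n; rewrite geq_max => /andP[/hN n1 /hM n2].
  rewrite (le_lt_trans (normc_le_ReIm _))// (splitr e).
  by move: n1 n2; rewrite /g; case: (f n s) => ? ? /= n1 n2; exact: ltrD.
have key e : 0 < e -> exists N, forall n, (N <= n)%N ->
    (\esum_(s in setT) (normc (f n s - g s) * mu s)%:E <= e%:E)%E.
  move=> e0; have [N hN] := cf e e0; exists N => n Nn.
  apply: ge_ereal_sup => _ [F [finF _] <-]; rewrite fsbig_finite//=.
  rewrite sumEFin lee_fin.
  apply/ler_addgt0Pr => d d0.
  set K := finmap.enum_fset (fset_set F); pose c := d / ((size K)%:R + 1).
  have c0 : 0 < c by rewrite divr_gt0// ltr_wpDl.
  have /choice[M hM] : forall s, exists M, forall m, (M <= m)%N -> normc (f m s - g s) * mu s < c.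
    move=> s; have [M hM] := fg s _ (divr_gt0 c0 (qw_gt0 s)).
    by exists M => m /hM; rewrite ltr_pdivlMr.
  pose m := maxn N (\max_(s <- K) M s).
  have Nm : (N <= m)%N by rewrite leq_maxl.
  apply: (@le_trans _ _ (\sum_(s <- K) (normc (f n s - f m s) * mu s + c))).
    rewrite big_seq [leRHS]big_seq; apply: ler_sum => s sK.
    rewrite (@le_trans _ _ (normc (f n s - f m s) * mu s + normc (f m s - g s) * mu s))//.
      rewrite -mulrDl ler_wpM2r//.
      by rewrite -[X in normc X](subrKA (f m s)) normc_triangle.
    rewrite lerD2l ltW// hM// (leq_trans _ (leq_maxr _ _))//.
    exact: leq_bigmax_seq.
  rewrite big_split/= lerD//.
    rewrite -lee_fin -sumEFin; apply: le_trans (_ : (ell1_norm (f n - f m))%:E <= _)%E.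
      rewrite -ell1_normE; apply: esum_ge; exists F => //.
      by rewrite fsbig_finite.
    by rewrite lee_fin ltW// hN.
  rewrite big_const_seq count_predT iter_addr_0 -mulr_natl.
  rewrite /c mulrCA ger_pMr// ler_pdivrMr ?ltr_wpDl// mul1r lerDl//.
have gP : g \in ell1_pred.
  have [N /(_ N (leqnn N)) hN] := key 1 ltr01.
  have hd : (f N : X -> R[i]^o) - g \in ell1_pred by rewrite inE /= (le_lt_trans hN)// ltry.
  have -> : g = (f N : X -> R[i]^o) - ((f N : X -> R[i]^o) - g) by rewrite opprB addrC subrK.
  by apply: rpredB => //; exact: valP.
exists (Ell1 gP) => e e0; have [N hN] := key (e / 2) (divr_gt0 e0 (ltr0n _ 2)).
exists N => n Nn; rewrite (@le_lt_trans _ _ (e / 2))//; last first.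
  by rewrite ltr_pdivrMr// ltr_pMr// ltr1n.
by rewrite -lee_fin -ell1_normE; exact: hN.
Qed.

End Ell1.

Record banach_algebra (R : realType) := BanachAlgebra {
  ba_carrier :> algType R[i];
  ba_norm : ba_carrier -> R;
  ba_norm_eq0 : forall x, ba_norm x = 0 -> x = 0;
  ba_normD : forall x y, ba_norm (x + y) <= ba_norm x + ba_norm y;
  ba_normZ : forall (c : R[i]) x, ba_norm (c *: x) = normc c * ba_norm x;
  ba_normM : forall x y, ba_norm (x * y) <= ba_norm x * ba_norm y;
  ba_norm1 : ba_norm 1 = 1;
  ba_complete : forall x : nat -> ba_carrier,
    (forall e : R, 0 < e -> exists N, forall m n, (N <= m)%N -> (N <= n)%N ->
       ba_norm (x m - x n) < e) ->
    exists l, forall e : R, 0 < e -> exists N, forall n, (N <= n)%N ->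
      ba_norm (x n - l) < e
}.

Definition ell1 (R : realType) (S : zeroMonoidType) (mu : quasi_weight R S) :
    banach_algebra R :=
  @BanachAlgebra R (ell1_space mu) (@ell1_norm R S mu)
    (@ell1_norm_eq0 R S mu) (@ell1_normD R S mu) (@ell1_normZ R S mu)
    (@ell1_normM R S mu) (etrans (ell1_norm_delta mu (one_nz S)) (qw1 mu))
    (@ell1_complete R S mu).

Section PurelyInfinite.
Context (R : realType) (A : banach_algebra R).
Implicit Types (a b c d p q : A) (x : \bar R).
Local Notation "\norm a" := (ba_norm a) (at level 10, a at level 8).

Definition idem_equiv p q := exists a b, p = a * b /\ q = b * a.

Definition idem_orth p q := p * q = 0 /\ q * p = 0.

(* ereal_inf set0 = +oo *)
Definition C_PI : \bar R := ereal_inf [set x | exists a b c d,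
  [/\ a * b = 1, c * d = 1, a * d = 0, c * b = 0 &
      x = (\norm a * \norm b * \norm c * \norm d)%:E]].

Definition C_PI' : \bar R := ereal_inf [set x | exists p q,
  [/\ p ^+ 2 = p /\ q ^+ 2 = q, idem_equiv p 1, idem_equiv 1 q,
      idem_orth p q & x = (\norm p * \norm q)%:E]].

End PurelyInfinite.

Inductive cu2_letter := La1 | La2 | Lb1 | Lb2 | Lzero.

Definition cu2_letter_code (x : cu2_letter) : 'I_5 :=
  inord match x with La1 => 0 | La2 => 1 | Lb1 => 2 | Lb2 => 3 | Lzero => 4 end.
Definition cu2_letter_decode (i : 'I_5) : cu2_letter :=
  match val i with 0 => La1 | 1 => La2 | 2 => Lb1 | 3 => Lb2 | _ => Lzero end.
Lemma cu2_letter_codeK : cancel cu2_letter_code cu2_letter_decode.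
Proof. by case; rewrite /cu2_letter_code /cu2_letter_decode /= inordK. Qed.
HB.instance Definition _ := Choice.copy cu2_letter (can_type cu2_letter_codeK).

Definition cu2_word := seq cu2_letter.

(* Monoid presentation of Cu2: the zero element is an additional generator
   Lzero, subject to Lzero x = Lzero = x Lzero for every generator x. *)
Inductive cu2_rel : cu2_word -> cu2_word -> Prop :=
| cu2_a1b1 : cu2_rel [:: La1; Lb1] [::]
| cu2_a2b2 : cu2_rel [:: La2; Lb2] [::]
| cu2_a1b2 : cu2_rel [:: La1; Lb2] [:: Lzero]
| cu2_a2b1 : cu2_rel [:: La2; Lb1] [:: Lzero]
| cu2_zerol x : cu2_rel [:: Lzero; x] [:: Lzero]
| cu2_zeror x : cu2_rel [:: x; Lzero] [:: Lzero].

Inductive cu2_cong : cu2_word -> cu2_word -> Prop :=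
| cu2_cong_rel u v : cu2_rel u v -> cu2_cong u v
| cu2_cong_refl u : cu2_cong u u
| cu2_cong_sym u v : cu2_cong u v -> cu2_cong v u
| cu2_cong_trans v u w : cu2_cong u v -> cu2_cong v w -> cu2_cong u w
| cu2_cong_cat u u' v v' : cu2_cong u u' -> cu2_cong v v' ->
    cu2_cong (u ++ v) (u' ++ v').

Definition cu2_congb : rel cu2_word := fun u v => `[< cu2_cong u v >].

Lemma cu2_congb_refl : reflexive cu2_congb.
Proof. by move=> u; apply/asboolP/cu2_cong_refl. Qed.
Lemma cu2_congb_sym : symmetric cu2_congb.
Proof. by move=> u v; apply: asbool_equiv_eq; split; apply: cu2_cong_sym. Qed.
Lemma cu2_congb_trans : transitive cu2_congb.
Proof.
by move=> v u w /asboolP uv /asboolP vw; apply/asboolP/(cu2_cong_trans uv vw).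
Qed.

Canonical cu2_equiv :=
  EquivRel cu2_congb cu2_congb_refl cu2_congb_sym cu2_congb_trans.

Definition Cu2 := {eq_quot cu2_equiv}.
HB.instance Definition _ := Choice.on Cu2.
HB.instance Definition _ := Quotient.on Cu2.

Definition cu2_of (u : cu2_word) : Cu2 := \pi_Cu2 u.

Lemma cu2_ofP (u v : cu2_word) : cu2_of u = cu2_of v <-> cu2_cong u v.
Proof.
split => [/eqmodP/asboolP //|uv]; apply/eqmodP; exact/asboolP.
Qed.

Lemma cu2_repr (x : Cu2) : cu2_of (repr x) = x. Proof. exact: reprK. Qed.

Definition cu2_mul (x y : Cu2) : Cu2 := cu2_of (repr x ++ repr y).

Lemma cu2_mulE u v : cu2_mul (cu2_of u) (cu2_of v) = cu2_of (u ++ v).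
Proof. by apply/cu2_ofP/cu2_cong_cat; apply/cu2_ofP/cu2_repr. Qed.

Lemma cu2_mulA : associative cu2_mul.
Proof.
move=> x y z; rewrite -[x]cu2_repr -[y]cu2_repr -[z]cu2_repr.
by rewrite !cu2_mulE catA.
Qed.

Lemma cu2_mul1l : left_id (cu2_of [::]) cu2_mul.
Proof. by move=> x; rewrite -[x]cu2_repr cu2_mulE. Qed.

Lemma cu2_mul1r : right_id (cu2_of [::]) cu2_mul.
Proof. by move=> x; rewrite -[x]cu2_repr cu2_mulE cats0. Qed.

HB.instance Definition _ := isMonoid.Build Cu2 cu2_mulA cu2_mul1l cu2_mul1r.

Lemma cu2_mul0 : left_zero (cu2_of [:: Lzero]) cu2_mul.
Proof.
move=> x; rewrite -[x]cu2_repr cu2_mulE; elim: (repr x) => [//|l u IHu].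
rewrite -[l :: u]cat1s catA -cu2_mulE (_ : cu2_of ([:: Lzero] ++ [:: l]) = cu2_of [:: Lzero]).
  by rewrite cu2_mulE.
by apply/cu2_ofP/cu2_cong_rel; constructor.
Qed.

Lemma cu2_mulr0 : right_zero (cu2_of [:: Lzero]) cu2_mul.
Proof.
move=> x; rewrite -[x]cu2_repr cu2_mulE; elim: (repr x) => [//|l u IHu].
rewrite -[l :: u]cat1s -catA -cu2_mulE IHu cu2_mulE.
by apply/cu2_ofP/cu2_cong_rel; constructor.
Qed.

(* Partial action of the generators on binary words, which shows that the
   identity of Cu2 differs from its zero. *)
Definition cu2_act1 (x : cu2_letter) (o : option (seq bool)) : option (seq bool) :=
  match x, o with
  | La1, Some (false :: w) | La2, Some (true :: w) => Some w
  | Lb1, Some w => Some (false :: w)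
  | Lb2, Some w => Some (true :: w)
  | _, _ => None
  end.

Lemma cu2_act_cong u v : cu2_cong u v ->
  forall o, foldr cu2_act1 o u = foldr cu2_act1 o v.
Proof.
elim=> //.
- by move=> _ _ [||||[]|[]] [w|].
- by move=> ? ? ? _ IH1 _ IH2 o; rewrite IH1 IH2.
- by move=> ? ? ? ? _ IH1 _ IH2 o; rewrite !foldr_cat IH1 IH2.
Qed.

Lemma cu2_one_neq0 : cu2_of [::] != cu2_of [:: Lzero].
Proof. by apply/eqP => /cu2_ofP/cu2_act_cong/(_ (Some [::])). Qed.

HB.instance Definition _ :=
  Monoid_hasZero.Build Cu2 cu2_mul0 cu2_mulr0 cu2_one_neq0.

(* Main.v *)
(* The monoid Cu2 is graded by deg b_i = 1, deg a_i = -1. Let the weight be 1 in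
   degree 0 and M = 2n elsewhere. The idempotents b_i a_i have degree 0, hence
   norm 1, so C'_PI = 1. Up to an error |f||g|/M, evaluation at the identity is
   multiplicative, because s t = e with deg t = 0 forces s = t = e. Hence small
   a, b, c, d with ab = 1 = cd and ad = 0 = cb would have scalar values at e
   almost satisfying the same relations, which is impossible in a commutative
   ring. *)
Require Import Defs.
From mathcomp Require Import all_boot all_order all_algebra.
From mathcomp Require Import reals constructive_ereal.
From mathcomp Require Import monoid classical_sets ereal esum complex ring lra.

Set Implicit Arguments.
Unset Strict Implicit.
Unset Printing Implicit Defensive.

Import Order.TTheory GRing.Theory Num.Theory.

Local Open Scope classical_set_scope.
Local Open Scope ring_scope.

Local Notation normc := Normc.normc.

(** * The grading by degree *)

Definition letter_deg (x : cu2_letter) : int :=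
  match x with La1 | La2 => -1 | Lb1 | Lb2 => 1 | Lzero => 0 end.

Definition word_deg (u : cu2_word) : int := \sum_(x <- u) letter_deg x.

Lemma cu2_ofM u v : (cu2_of u * cu2_of v)%g = cu2_of (u ++ v).
Proof. exact: cu2_mulE. Qed.

(** [a_i b_i = 1] preserves the degree. The other relations need not, but both their sides represent
    [zerog], which absorbs under concatenation. *)
Lemma word_deg_cong u v : cu2_cong u v ->
  cu2_of u = zerog \/ word_deg u = word_deg v.
Proof.
elim=> {u v}.
- move=> u v uv; have /cu2_ofP e := cu2_cong_rel uv; move: e.
  by case: uv => [||||x|x] e; [right|right|left|left|left|left];
    rewrite /word_deg ?big_cons ?big_nil ?e.
- by move=> u; right.
- by move=> u v /cu2_ofP <- [->|->]; [left|right].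
- move=> v u w /cu2_ofP uv IHu /cu2_ofP vw IHv.
  by case: IHu => [->|->]; [left|rewrite uv].
- move=> u u' v v' _ IHu _ IHv; rewrite -cu2_ofM.
  case: IHu => [->|eu]; first by left; rewrite mul0g.
  case: IHv => [->|ev]; first by left; rewrite mulg0.
  by right; rewrite /word_deg !big_cat /=; congr (_ + _).
Qed.

(** At [zerog] the value depends on the chosen representative; elsewhere [cu2_degE] computes it from
    any representing word. *)
Definition cu2_deg (s : Cu2) : int := word_deg (repr s).

Lemma cu2_degE u : cu2_of u != zerog -> cu2_deg (cu2_of u) = word_deg u.
Proof.
move=> u0; have /cu2_ofP/word_deg_cong[] // := cu2_repr (cu2_of u).
by rewrite cu2_repr => e; rewrite e eqxx in u0.
Qed.

Lemma cu2_degM s t : (s * t)%g != zerog ->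
  cu2_deg (s * t)%g = cu2_deg s + cu2_deg t.
Proof.
rewrite -{1 2}[s]cu2_repr -{1 2}[t]cu2_repr cu2_ofM => /cu2_degE ->.
by rewrite /word_deg big_cat.
Qed.

(** * Factorizations of the identity *)

Definition bword (w : seq bool) : cu2_word :=
  [seq if i then Lb2 else Lb1 | i <- w].

(** Induction on [u]: [b_i] prepends a letter, and [a_i] acts only on a word with matching head,
    where it cancels by [a_i b_i = 1]. *)
Lemma act_nil_bword u w : foldr cu2_act1 (Some [::]) u = Some w ->
  cu2_of u = cu2_of (bword w).
Proof.
elim: u w => [w [<-]//|x u IH] w /=.
case e : (foldr _ _ u) => [w'|]; last by case: x.
rewrite -[x :: u]cat1s -cu2_ofM (IH _ e) cu2_ofM.
case: x => /=.
- case: w' {e} => [//|[]// w'] [->]; rewrite -[RHS]/(cu2_of ([::] ++ bword w)).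
  by rewrite -[in RHS]cu2_ofM -(iffRL (cu2_ofP _ _) (cu2_cong_rel cu2_a1b1)) cu2_ofM.
- case: w' {e} => [//|[]// w'] [->]; rewrite -[RHS]/(cu2_of ([::] ++ bword w)).
  by rewrite -[in RHS]cu2_ofM -(iffRL (cu2_ofP _ _) (cu2_cong_rel cu2_a2b2)) cu2_ofM.
- by case=> <-.
- by case=> <-.
- by [].
Qed.

Lemma word_deg_bword w : word_deg (bword w) = (size w)%:Z.
Proof.
rewrite /word_deg /bword big_map; elim: w => [|i w IH]; rewrite ?big_nil// big_cons IH.
by case: i.
Qed.

(* [t] sends the empty word to a word [w], hence [t = b_w] has degree [size w]. *)
Lemma cu2_mul_eq1 (s t : Cu2) :
  (s * t)%g = 1%g -> cu2_deg t = 0 -> s = 1%g /\ t = 1%g.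
Proof.
move=> st1 dt; suff t1 : t = 1%g by move: st1; rewrite t1 mulg1.
have t0 : t != zerog.
  by apply: contra_eq_neq st1 => ->; rewrite mulg0 eq_sym oneg_neq0.
have : cu2_of (repr s ++ repr t) = cu2_of [::].
  by rewrite -cu2_ofM !cu2_repr st1.
move=> /cu2_ofP/cu2_act_cong/(_ (Some [::])); rewrite foldr_cat/=.
case e : (foldr _ _ (repr t)) => [w|]; last first.
  (* [None] is absorbing, so [s t] would not fix the empty word. *)
  move=> h; exfalso; move: h; elim: (repr s) => //= x u IH.
  have h0 : foldr cu2_act1 None u = None by elim: u {IH} => //= -[] u ->.
  by rewrite h0; case: x.
have {e} := act_nil_bword e; rewrite cu2_repr => tb _.
have : word_deg (bword w) = 0 by rewrite -cu2_degE -tb.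
by rewrite word_deg_bword tb => -[/size0nil ->].
Qed.

(** * The weight and evaluation at the identity *)

Section Weight.
Context (R : realType) (M : R).
Hypothesis M1 : 1 <= M.

(** The value at [zerog] is forced: [0 * 0 = 0] makes it at least 1, and [(b_1 a_1) (b_2 a_2) = 0],
    with both factors of weight 1, at most 1. *)
Definition cu2_weight (s : Cu2) : R :=
  if (s == zerog) || (cu2_deg s == 0) then 1 else M.

Lemma cu2_weight_ge1 s : 1 <= cu2_weight s.
Proof. by rewrite /cu2_weight; case: ifP. Qed.

Lemma cu2_deg1 : cu2_deg 1%g = 0.
Proof. by rewrite (cu2_degE cu2_one_neq0) /word_deg big_nil. Qed.

(** A product of nonzero degree has a factor of nonzero degree, of weight [M]; the other factor has
    weight at least 1. *)
Lemma cu2_weight_is_weight : is_weight cu2_weight.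
Proof.
split=> [s|s t|]; first exact: lt_le_trans (cu2_weight_ge1 s).
  have [s1 t1] := (cu2_weight_ge1 s, cu2_weight_ge1 t).
  have h : 1 <= cu2_weight s * cu2_weight t by exact: mulr_ege1.
  rewrite {1}/cu2_weight; case: ifP => // /negbT; rewrite negb_or => /andP[st0].
  rewrite cu2_degM// => d.
  have [ds|ds] := eqVneq (cu2_deg s) 0.
    have -> : cu2_weight t = M.
      rewrite /cu2_weight ifN// negb_or; move: d; rewrite ds add0r => ->.
      by rewrite andbT; apply: contraNneq st0 => ->; rewrite mulg0.
    by rewrite ler_peMl// (le_trans ler01).
  have -> : cu2_weight s = M.
    rewrite /cu2_weight ifN// negb_or ds andbT.
    by apply: contraNneq st0 => ->; rewrite mul0g.
  by rewrite ler_peMr// (le_trans ler01).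
by rewrite /cu2_weight cu2_deg1 eqxx orbT.
Qed.

Definition cu2_qweight : quasi_weight R Cu2 :=
  QuasiWeight (ex_intro2 (fun w : Cu2 -> R => is_weight w)
    (fun w => forall s : nonzero Cu2, cu2_weight (val s) = w (val s))
    cu2_weight cu2_weight_is_weight (fun=> erefl)).

Local Notation A := (ell1 cu2_qweight).
Local Notation e := (one_nz Cu2).

(* Evaluation at the identity is almost multiplicative: a factorization
   [s * t = 1] other than [1 * 1] has [t] of nonzero degree. *)
Lemma eval1_mul (f g : A) :
  normc ((f * g : A) e - f e * g e) <= ba_norm f * ba_norm g / M.
Proof.
have M0 : 0 < M by exact: lt_le_trans M1.
pose F (p : nonzero Cu2 * nonzero Cu2) := f p.1 * g p.2.
(* The convolution at [e] splits into the term [f e * g e] and the error, the sum of [h2]. *)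
pose h1 p := if p == (e, e) then F p else 0.
pose h2 p := if p == (e, e) then 0 else F p.
have sF : csummable (factorizations e) F := csummable_ell1_conv f g e.
have sh1 : csummable (factorizations e) h1.
  apply: csummable_le sF => p _; rewrite /h1; case: ifP => // _.
  by rewrite Normc.normc0 normc_ge0.
have sh2 : csummable (factorizations e) h2.
  apply: csummable_le sF => p _; rewrite /h2; case: ifP => // _.
  by rewrite Normc.normc0 normc_ge0.
have -> : (f * g : A) e = csum (factorizations e) h1 + csum (factorizations e) h2.
  rewrite -csumD//; apply: eq_csum => p _; rewrite /h1 /h2 -/(F p).
  by case: ifP; rewrite ?addr0 ?add0r.
rewrite (@csum_single _ _ _ h1 (e, e)); last 2 first.
- by rewrite /factorizations/= mulg1.
- by move=> p _ /negbTE; rewrite /h1 => ->.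
rewrite {1}/h1 eqxx /F/= addrAC subrr add0r -lee_fin.
apply: le_trans (normc_csum_le sh2) _.
pose a p := (normc (f p.1) * cu2_qweight p.1) * (normc (g p.2) * cu2_qweight p.2).
have a0 p : 0 <= a p by rewrite /a !mulr_ge0// ?normc_ge0// qw_ge0.
rewrite mulrC EFinM -(esum_ell1_pair f g) -esumZl ?invr_ge0 ?(ltW M0)//; last first.
  by move=> p _; exact: a0.
apply: (@le_trans _ _ (\esum_(p in factorizations e) (M^-1 * a p)%:E)); last first.
  by apply: esum_subset => // p; rewrite mulr_ge0// invr_ge0 ltW.
(* Off [(e, e)] the right factor has weight [M] and the left one at least 1, which gains the factor
   [M^-1] termwise. *)
apply: le_esum => p pe; rewrite lee_fin ler_pdivlMl//.
rewrite /h2; case: ifP => [_|/negbT ne]; first by rewrite Normc.normc0 mulr0.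
rewrite Normc.normcM /a mulrACA [leLHS]mulrC ler_wpM2l//.
  by rewrite mulr_ge0// normc_ge0.
have -> : cu2_qweight p.2 = M.
  rewrite /= /cu2_weight ifN// negb_or (valP p.2)/=.
  apply: contra_neq ne => d.
  have [p1 p2] := cu2_mul_eq1 pe d.
  by case: p {pe d} p1 p2 => s t /= s1 t1; congr pair; apply: val_inj.
by rewrite ler_peMl ?(ltW M0)// cu2_weight_ge1.
Qed.

End Weight.

(** * Norms of idempotents and the lower bounds for both constants *)

Lemma ba_norm_ge0 (R : realType) (A : banach_algebra R) (x : A) : 0 <= ba_norm x.
Proof.
have n0 : ba_norm (0 : A) = 0.
  by rewrite -(scale0r (1 : A)) ba_normZ Normc.normc0 mul0r.
have := ba_normD x (- x); rewrite subrr n0 -scaleN1r ba_normZ.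
by rewrite normcN Normc.normc1 mul1r; lra.
Qed.

Lemma ba_norm_idem_ge1 (R : realType) (A : banach_algebra R) (p : A) :
  p ^+ 2 = p -> p != 0 -> 1 <= ba_norm p.
Proof.
move=> pp p0; have := ba_normM p p; rewrite -expr2 pp.
have : ba_norm p != 0 by apply: contra_neq p0; exact: ba_norm_eq0.
by have := ba_norm_ge0 p; nra.
Qed.

(** If [p = a b] and [1 = b a], then [1 = (b a) (b a) = b p a]. *)
Lemma idem_equiv1_neq0 (R : realType) (A : banach_algebra R) (p : A) :
  idem_equiv p 1 -> p != 0.
Proof.
move=> [a [b [pE oneE]]]; apply/eqP => p0.
have : (1 : A) * 1 = 0.
  by rewrite [X in X * _]oneE [X in _ * X]oneE mulrA -(mulrA b) -pE p0 mulr0 mul0r.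
by rewrite mulr1 => /eqP; rewrite oner_eq0.
Qed.

Lemma C_PI'_ge1 (R : realType) (A : banach_algebra R) : (1 <= C_PI' A)%E.
Proof.
apply: le_ereal_inf_tmp => _ [p [q [[pp qq] ep [a [b [e1 e2]]] _ ->]]].
rewrite lee_fin mulr_ege1//; first exact/ba_norm_idem_ge1/idem_equiv1_neq0.
by apply: ba_norm_idem_ge1 => //; apply: idem_equiv1_neq0; exists b, a.
Qed.

(* With [alpha = `|a(1)|], etc., the values at the identity would satisfy
   [alpha beta gamma delta > 1/4] and [alpha beta gamma delta <= x y z t / M^2]. *)
Lemma matrix_units_bound (R : realFieldType) (n al be ga de x y z t : R) :
  1 <= n -> 0 <= al -> 0 <= be -> 0 <= ga -> 0 <= de ->
  1 <= x * y -> 1 <= z * t ->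
  1 <= x * y / (2 * n) + al * be -> 1 <= z * t / (2 * n) + ga * de ->
  al * de <= x * t / (2 * n) -> ga * be <= z * y / (2 * n) ->
  n <= x * y * z * t.
Proof.
move=> n1 al0 be0 ga0 de0 xy zt h1 h2 h3 h4; rewrite leNgt; apply/negP => h.
have M0 : 0 < 2 * n by lra.
have e1 : x * y < n.
  by apply: le_lt_trans h; rewrite -(mulrA (x * y)) ler_peMr//; lra.
have e2 : z * t < n.
  by apply: le_lt_trans h; rewrite -(mulrA (x * y)) ler_peMl//; lra.
(* The choice [M = 2 n] keeps the errors in [h1] and [h2] below 1/2. *)
have half u : u < n -> u / (2 * n) < 1 / 2 by move=> un; rewrite ltr_pdivrMr//; lra.
have {h1}g1 : 1 / 2 <= al * be by have := half _ e1; lra.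
have {h2}g2 : 1 / 2 <= ga * de by have := half _ e2; lra.
have low : (1 / 2) * (1 / 2) <= (al * be) * (ga * de) by apply: ler_pM => //; lra.
(* By commutativity this is the product bounded below in [low]; the right side is
   [x y z t / (4 n^2) < 1/4]. *)
have up : (al * de) * (ga * be) <= (x * t / (2 * n)) * (z * y / (2 * n)).
  by apply: ler_pM => //; exact: mulr_ge0.
have e3 : (x * t / (2 * n)) * (z * y / (2 * n)) = (x * y * z * t / n) / n / 4.
  by field; lra.
have e4 : x * y * z * t / n < 1 by rewrite ltr_pdivrMr; lra.
have e5 : x * y * z * t / n / n < 1 by rewrite ltr_pdivrMr; lra.
have e6 : (al * de) * (ga * be) = (al * be) * (ga * de) by ring.
by move: up; rewrite e6 e3; lra.
Qed.

(** [eval1_mul] transfers the four relations to the moduli of the values at [e], where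
    [matrix_units_bound] applies. *)
Lemma C_PI_ge_cu2 (R : realType) (n : R) (hn : 1 <= n) (hM : 1 <= 2 * n) :
  (n%:E <= C_PI (ell1 (cu2_qweight hM)))%E.
Proof.
apply: le_ereal_inf_tmp => _ [a [b [c [d [ab cd ad cb ->]]]]].
set A := ell1 _ in a b c d ab cd ad cb *; rewrite lee_fin.
pose e := one_nz Cu2.
have ge1 (x y : A) : x * y = 1 -> 1 <= ba_norm x * ba_norm y.
  by move=> xy; rewrite -(ba_norm1 A) -xy ba_normM.
have val1 (x y : A) : x * y = 1 ->
    1 <= ba_norm x * ba_norm y / (2 * n) + normc (x e) * normc (y e).
  move=> xy; have := eval1_mul x y; rewrite xy /= /ell1_delta_fun eqxx.
  rewrite -Normc.normcM => h.
  rewrite -[leLHS](Normc.normc1 R) -[X in normc X](subrK (x e * y e)).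
  by apply: le_trans (normc_triangle _ _) _; rewrite lerD2r.
have val0 (x y : A) : x * y = 0 ->
    normc (x e) * normc (y e) <= ba_norm x * ba_norm y / (2 * n).
  move=> xy; have := eval1_mul x y; rewrite xy -Normc.normcM.
  by rewrite -[X in normc (X - _)]/(0 : R[i]) sub0r normcN.
apply: (@matrix_units_bound _ _ (normc (a e)) (normc (b e)) (normc (c e))
  (normc (d e))); rewrite ?normc_ge0//; by [exact: ge1|exact: val1|exact: val0].
Qed.

(** * Idempotents attaining the infimum, and the conclusion *)

Lemma C_PI'_cu2 (R : realType) (M : R) (hM : 1 <= M) :
  C_PI' (ell1 (cu2_qweight hM)) = 1%E.
Proof.
apply/eqP; rewrite eq_le C_PI'_ge1 andbT.
(* [Lzero] sends everything to [None], so a word defined at some [w] is nonzero; the [w] supplied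
   below are such witnesses. *)
have nz u w : foldr cu2_act1 (Some w) u != None -> cu2_of u != zerog.
  by apply: contra_neq => /cu2_ofP/cu2_act_cong ->.
pose X u w h : nonzero Cu2 := exist _ (cu2_of u) (nz u w h).
pose b1 := X [:: Lb1] [::] isT; pose a1 := X [:: La1] [:: false] isT.
pose b2 := X [:: Lb2] [::] isT; pose a2 := X [:: La2] [:: true] isT.
pose p1 := X [:: Lb1; La1] [:: false] isT.
pose p2 := X [:: Lb2; La2] [:: true] isT.
pose D s : ell1 (cu2_qweight hM) := ell1_delta (cu2_qweight hM) s.
have r1 : (val a1 * val b1)%g = 1%g.
  by rewrite cu2_ofM; apply/cu2_ofP/cu2_cong_rel/cu2_a1b1.
have r2 : (val a2 * val b2)%g = 1%g.
  by rewrite cu2_ofM; apply/cu2_ofP/cu2_cong_rel/cu2_a2b2.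
have r12 : (val a1 * val b2)%g = zerog.
  by rewrite cu2_ofM; apply/cu2_ofP/cu2_cong_rel/cu2_a1b2.
have r21 : (val a2 * val b1)%g = zerog.
  by rewrite cu2_ofM; apply/cu2_ofP/cu2_cong_rel/cu2_a2b1.
have ba1 : D p1 = D b1 * D a1 by apply/esym/ell1_deltaM; rewrite cu2_ofM.
have ba2 : D p2 = D b2 * D a2 by apply/esym/ell1_deltaM; rewrite cu2_ofM.
have ab1 : D a1 * D b1 = 1 by exact: ell1_deltaM.
have ab2 : D a2 * D b2 = 1 by exact: ell1_deltaM.
have ab12 : D a1 * D b2 = 0 by exact: ell1_deltaM0.
have ab21 : D a2 * D b1 = 0 by exact: ell1_deltaM0.
have n1 : ba_norm (D p1) = 1.
  by rewrite /= ell1_norm_delta /= /cu2_weight cu2_degE ?(valP p1)//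
    /word_deg !big_cons big_nil eqxx orbT.
have n2 : ba_norm (D p2) = 1.
  by rewrite /= ell1_norm_delta /= /cu2_weight cu2_degE ?(valP p2)//
    /word_deg !big_cons big_nil eqxx orbT.
apply: ereal_inf_lbound; exists (D p1), (D p2); split.
- by rewrite !expr2 ba1 ba2 !mulrA -(mulrA (D b1)) -(mulrA (D b2)) ab1 ab2 !mulr1.
- by exists (D b1), (D a1).
- by exists (D a2), (D b2).
- split; rewrite ba1 ba2 mulrA; first by rewrite -(mulrA (D b1)) ab12 mulr0 mul0r.
  by rewrite -(mulrA (D b2)) ab21 mulr0 mul0r.
- by rewrite n1 n2 mulr1.
Qed.

Theorem proposition4p14 (R : realType) (n : nat) (hn : (1 <= n)%N) :
  exists mu : quasi_weight R Cu2,
    C_PI' (ell1 mu) = 1%E /\ (n%:R%:E <= C_PI (ell1 mu))%E.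
Proof.
have n1 : 1 <= n%:R :> R by rewrite ler1n.
have hM : 1 <= 2 * n%:R :> R by lra.
by exists (cu2_qweight hM); split; [exact: C_PI'_cu2|exact: C_PI_ge_cu2].
Qed.
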